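(* Let $G$ be a pseudo-outerplanar graph with minimum degree at least $2$. Then $G$ contains at least one of the following configurations (where $d(\cdot)$ denotes degree in $G$): (a) a vertex $u$ with $d(u)=2$ adjacent to a vertex $v$ with $d(v)\leq 4$; (b) a path $v_1u_1v_2u_2v_3u_3v_4$ such that $v_1v_2,v_1v_3,v_2v_3,v_2v_4,v_3v_4\in E(G)$, $d(u_1)=d(u_2)=d(u_3)=2$ and $d(v_2)=d(v_3)=5$; (c) a cycle $u_1u_2u_3u_4$ with $d(u_2)=d(u_4)=2$; (d) a cycle $u_1u_2u_3u_4$ with $u_2u_4\in E(G)$, $d(u_2)=d(u_4)=3$ and $d(u_3)\leq 4$; (e) a cycle $u_1u_2u_3u_4$ with $u_2u_4\in E(G)$, $d(u_2)=d(u_4)=3$, and $u_3$ adjacent to a vertex $v$ with $d(v)=2$; (f) a cycle $u_1u_2u_3u_4$ with $u_2u_4\in E(G)$, $d(u_2)=d(u_4)=3$, and $u_3$ adjacent to a vertex $v$ with $d(v)=3$ and to a vertex $x$ with $vx\in E(G)$; (g) a cycle $u_1u_2u_3u_4$ with $u_1u_3,u_2u_4\in E(G)$, $d(u_2)=d(u_4)=3$, and $u_3$ adjacent to a vertex $v$ with $u_1v\in E(G)$.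
   Context: All graphs are finite, simple and undirected. A graph is pseudo-outerplanar if each of its blocks has an embedding in the plane so that the vertices lie on a fixed circle and the edges lie inside the disk of this circle with each edge crossing at most one other edge. *)

(* Defs.v *)
From HB Require Import structures.
From mathcomp Require Import all_boot all_order all_algebra.
From mathcomp Require Import classical_sets reals topology normedtype.

Set Implicit Arguments.
Unset Strict Implicit.
Unset Printing Implicit Defensive.

Import Order.TTheory GRing.Theory Num.Theory.
Import numFieldNormedType.Exports.

Local Open Scope ring_scope.

Section Graph.
Variables (T : finType) (e : rel T).

Definition deg (x : T) : nat := #|[set y | e x y]|.

Definition induced (S : {set T}) : rel T :=
  [rel x y | [&& x \in S, y \in S & e x y]].

Definition edges_in (S : {set T}) : {set {set T}} :=
  [set [set x; y] | x in S, y in S & e x y].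

Definition connected_in (S : {set T}) : bool :=
  [forall x in S, forall y in S, connect (induced S) x y].

Definition cutvertex (S : {set T}) (v : T) : bool :=
  (v \in S) && ~~ connected_in (S :\ v).

Definition nonseparable (S : {set T}) : bool :=
  [&& S != finset.set0, connected_in S & [forall v, ~~ cutvertex S v]].

(* A maximal connected subgraph without a cut vertex is an induced subgraph,
   so a block is represented by its vertex set. *)
Definition block (S : {set T}) : bool := maxset nonseparable S.

End Graph.

Section Drawing.
Variable R : realType.

Definition on_unit_circle (p : R * R) : Prop := p.1 ^+ 2 + p.2 ^+ 2 = 1.

Definition in_unit_disk (p : R * R) : Prop := p.1 ^+ 2 + p.2 ^+ 2 <= 1.

Definition simple_arc (p q : R * R) (A : set (R * R)) : Prop :=
  exists f : R -> R * R,
    [/\ {within `[0, 1], continuous f}%classic,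
        {in `[0, 1] &, injective f},
        f 0 = p, f 1 = q & A = (f @` `[0, 1])%classic].

Variables (T : finType) (e : rel T).

(* [pos] places the vertices; [curve] gives, for each edge {x, y}, the point
   set of the simple arc drawn for it.  Arcs may run along the circle, but
   contain no vertex other than their two ends. *)
Record circle_drawing (S : {set T}) (pos : T -> R * R)
    (curve : {set T} -> set (R * R)) : Prop := CircleDrawing {
  pos_circle : {in S, forall x, on_unit_circle (pos x)};
  pos_inj : {in S &, injective pos};
  curve_arc : {in S &, forall x y, e x y ->
    simple_arc (pos x) (pos y) (curve [set x; y])};
  curve_disk : forall E, E \in edges_in e S ->
    forall p, curve E p -> in_unit_disk p;
  curve_vertex : forall E, E \in edges_in e S ->
    {in S, forall z, curve E (pos z) -> z \in E}
}.

(* Two distinct edges cross when their arcs meet at a point which is not the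
   position of a vertex (hence not a common end). *)
Definition crosses (S : {set T}) (pos : T -> R * R)
    (curve : {set T} -> set (R * R)) (E F : {set T}) : Prop :=
  E <> F /\ exists p, [/\ curve E p, curve F p & {in S, forall z, pos z <> p}].

Definition pseudo_outerplanar : Prop :=
  forall S : {set T}, block e S ->
    exists pos : T -> R * R, exists curve : {set T} -> set (R * R),
      circle_drawing S pos curve /\
      {in edges_in e S & &, forall E F F', crosses S pos curve E F ->
         crosses S pos curve E F' -> F = F'}.

End Drawing.

Arguments pseudo_outerplanar R {T} e.

Section Configurations.
Variables (T : finType) (e : rel T).
Local Notation d := (deg e).

Definition config_a : Prop :=
  exists u v, [/\ e u v, d u = 2%N & (d v <= 4)%N].

Definition config_b : Prop :=
  exists v1 u1 v2 u2 v3 u3 v4,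
    [/\ path e v1 [:: u1; v2; u2; v3; u3; v4],
        uniq [:: v1; u1; v2; u2; v3; u3; v4],
        [/\ e v1 v2, e v1 v3, e v2 v3, e v2 v4 & e v3 v4],
        [/\ d u1 = 2%N, d u2 = 2%N & d u3 = 2%N] &
        d v2 = 5%N /\ d v3 = 5%N].

Definition config_c : Prop :=
  exists u1 u2 u3 u4,
    [/\ ucycle e [:: u1; u2; u3; u4], d u2 = 2%N & d u4 = 2%N].

Definition diamond (u1 u2 u3 u4 : T) : Prop :=
  [/\ ucycle e [:: u1; u2; u3; u4], e u2 u4, d u2 = 3%N & d u4 = 3%N].

Definition config_d : Prop :=
  exists u1 u2 u3 u4, diamond u1 u2 u3 u4 /\ (d u3 <= 4)%N.

Definition config_e : Prop :=
  exists u1 u2 u3 u4 v, [/\ diamond u1 u2 u3 u4, e u3 v & d v = 2%N].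

(* In the next two configurations the extra vertices are new: otherwise
   v := u2 (with x := u4) would make them hold for every diamond, respectively
   for every diamond with the chord u1u3. *)
Definition config_f : Prop :=
  exists u1 u2 u3 u4 v x,
    [/\ diamond u1 u2 u3 u4, uniq [:: u1; u2; u3; u4; v; x],
        e u3 v /\ d v = 3%N, e u3 x & e v x].

Definition config_g : Prop :=
  exists u1 u2 u3 u4 v,
    [/\ diamond u1 u2 u3 u4, uniq [:: u1; u2; u3; u4; v],
        e u1 u3, e u3 v & e u1 v].

End Configurations.

(* Main.v *)
Require Import Defs.
From mathcomp Require Import boolp classical_sets reals topology normedtype.
From mathcomp Require Import all_boot all_order all_algebra.
From mathcomp Require Import zify ring lra.

Set Implicit Arguments.
Unset Strict Implicit.
Unset Printing Implicit Defensive.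

Import Order.TTheory GRing.Theory Num.Theory.
Import numFieldNormedType.Exports.

(* Take an end block and number its vertices 0, ..., n-1 around the circle, 0
   being its only possible cut vertex.  Two edges with interleaved ends have
   crossing arcs, so every edge is interleaved with at most one other edge.
   Call an interval [i, j] closed when no edge leaves its interior.  By
   induction on j - i, a closed interval either yields a configuration or is
   an edge (j = i+1), an ear (j = i+2, inner vertex of degree 2) or a diamond
   (j = i+3).  Indeed let w < j be maximal with [i, w] closed.  Either [w, j]
   is closed too, or [i, j] is spanned by two crossing edges i c and b j with
   i < b < c < j, and then [i, b], [b, c], [c, j] are closed; in both cases the
   smaller intervals are edges, ears or diamonds, which bounds the degrees of
   w, or of b and c.  The interval [0, n-1] is closed, and in the three small
   cases the vertex n-1 has degree at most 3.

   That arcs f from p1 to p3 and g from p2 to p4 in the disk meet when p1, p2,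
   p3, p4 are in circular order follows from the Poincare-Miranda theorem for
   two functions of (f s, g t) which have the right signs on the border of the
   unit square and vanish together only when f s = g t.  That theorem itself
   comes from a parity argument on fine grids and from compactness. *)

(** * The Poincare-Miranda theorem in the plane *)

Section Grid.
Implicit Types (F A B : nat -> nat -> bool) (n i j : nat).

Definition constant_on_cell F i j : Prop :=
  forall a b : bool, F (a + i) (b + j) = F i j.

Lemma nonconstant_on_cell F i j : ~ constant_on_cell F i j ->
  forall c, exists a b : bool, F (a + i) (b + j) = c.
Proof.
move=> /existsNP[a /existsNP[b ne]] c.
have [Fij|Fij] := eqVneq (F i j) c; first by exists false, false.
by exists a, b; case: c (F i j) (F (a + i) _) Fij ne => [] [] [].
Qed.

Section Doors.
Variables A B : nat -> nat -> bool.

(* As in Sperner's lemma: a cell on which [A] or [B] is constant has an even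
   number of doors, so that two columns joined by such cells have the same
   parity. *)
Definition door i j i' j' : bool :=
  [&& ~~ A i j, ~~ A i' j' & B i j (+) B i' j'].

Definition odd_doors i n : bool :=
  \big[addb/false]_(0 <= j < n) door i j i j.+1.

Lemma cell_doors_even i j : constant_on_cell A i j \/ constant_on_cell B i j ->
  door i j i j.+1 (+) door i.+1 j i.+1 j.+1
    = door i j i.+1 j (+) door i j.+1 i.+1 j.+1.
Proof.
rewrite /door => -[] cst.
  have /= -> := cst true true; have /= -> := cst true false.
  have /= -> := cst false true.
  case: (A i j) => //=.
  by case: (B i j); case: (B i.+1 j); case: (B i j.+1); case: (B i.+1 j.+1).
have /= -> := cst true true; have /= -> := cst true false.
have /= -> := cst false true.
by rewrite addbb !andbF.
Qed.

Lemma odd_doors_addb i n :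
  (forall j, j < n -> constant_on_cell A i j \/ constant_on_cell B i j) ->
  odd_doors i n (+) odd_doors i.+1 n = door i 0 i.+1 0 (+) door i n i.+1 n.
Proof.
elim: n => [|n IH] cst; first by rewrite /odd_doors !big_geq // !addbb.
rewrite /odd_doors !big_nat_recr //= addbACA cell_doors_even; last exact: cst.
rewrite [X in X (+) _]IH; last by move=> j /ltnW; apply: cst.
by rewrite addbA addbK.
Qed.

Lemma odd_doors_outside i n : (forall j, j <= n -> ~~ A i j) ->
  odd_doors i n = B i 0 (+) B i n.
Proof.
elim: n => [|n IH] Ai; first by rewrite /odd_doors big_geq // addbb.
rewrite /odd_doors big_nat_recr //= [X in X (+) _]IH; last by move=> j /leqW/Ai.
by rewrite /door !Ai //= addbA addbK.
Qed.

Lemma odd_doors_inside i n : (forall j, j <= n -> A i j) ->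
  odd_doors i n = false.
Proof.
move=> Ai; rewrite /odd_doors big_nat big1 // => j /andP[_ jn].
by rewrite /door Ai // ltnW.
Qed.

Lemma grid_nonconstant_cell n :
  (forall j, j <= n -> ~~ A 0 j) -> (forall j, j <= n -> A n j) ->
  (forall i, i <= n -> ~~ B i 0) -> (forall i, i <= n -> B i n) ->
  exists i j, [/\ i < n, j < n,
    ~ constant_on_cell A i j & ~ constant_on_cell B i j].
Proof.
move=> A0 An B0 Bn; apply: contrapT => no_cell.
have constant i j : i < n -> j < n ->
    constant_on_cell A i j \/ constant_on_cell B i j.
  move=> lin ljn; apply: contrapT => /not_orP[nA nB].
  by apply: no_cell; exists i, j.
have same_parity i : i <= n -> odd_doors i n = odd_doors 0 n.
  elim: i => // i IH lin; rewrite -IH ?(ltnW lin) //; apply/esym/eqP.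
  rewrite -[_ == _]negbK negb_eqb odd_doors_addb => [|j]; last exact: constant.
  have doorF j : B i j = B i.+1 j -> door i j i.+1 j = false.
    by move=> Bij; rewrite /door Bij addbb !andbF.
  rewrite !doorF // ?(negPf (B0 _ _)) ?Bn //; exact: ltnW.
have := same_parity n (leqnn n).
by rewrite odd_doors_inside // odd_doors_outside // Bn // (negPf (B0 _ _)).
Qed.

End Doors.
End Grid.

Section PoincareMiranda.
Local Open Scope ring_scope.
Local Open Scope classical_set_scope.
(* [fingraph] has another [closed]. *)
Local Notation closed := topology_structure.closed.
Variable R : realType.
Local Notation I01 := (`[0, 1] : set R).
Local Notation square := (I01 `*` I01).

Lemma compact_near_closed_family (M : pseudoMetricType R) (I : Type)
    (K : set M) (C : I -> set M) :
  compact K -> (forall i, closed (C i)) ->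
  (forall r : R, 0 < r ->
     exists2 x, K x & forall i, exists2 y, C i y & ball x r y) ->
  exists2 x, K x & forall i, C i x.
Proof.
move=> /compact_near_coveringP covK clC near_all; apply: contrapT => no_meet.
have : \forall r \near 0^'+,
    K `<=` [set x | ~ forall i, exists2 y, C i y & ball x r y].
  apply: covK => x Kx.
  have /existsNP[i nCx] : ~ forall i, C i x.
    by move=> Cx; apply: no_meet; exists x.
  have /nbhs_ballP[r /= r0 sub] : nbhs x (~` C i).
    by apply: open_nbhs_nbhs; split=> //; apply: closed_openC.
  have r2 : 0 < r / 2 by rewrite divr_gt0.
  exists (ball x (r / 2), [set s | s < r / 2]) => /=.
    by split; [apply: nbhsx_ballx | apply: nbhs_right_lt].
  move=> [y s] /= [xy sr] /(_ i)[w Cw yw]; apply: (sub w) => //.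
  by apply: (ball_split xy); apply: le_ball yw; apply: ltW.
move=> /(filterI (nbhs_right_gt _))/filter_ex[r [r0 nK]].
by have [x Kx near_x] := near_all r r0; apply: nK near_x.
Qed.

Lemma within_continuous_closed (M N : topologicalType) (K : set M) (D : set N)
    (f : M -> N) :
  closed K -> {within K, continuous f} -> closed D -> closed (K `&` f @^-1` D).
Proof.
by move=> clK /continuous_closedP cf clD; rewrite closed_setSI //; apply: cf.
Qed.

Definition weak_sign (c : bool) (x : R) : bool := if c then 0 <= x else x <= 0.

Lemma weak_sign_eq0 x : (forall c, weak_sign c x) -> x = 0.
Proof.
move=> sx; apply/le_anti/andP.
by split; [apply: (sx false) | apply: (sx true)].
Qed.

Lemma closed_weak_sign c : closed [set x | weak_sign c x].
Proof. by case: c; [apply: closed_ge | apply: closed_le]. Qed.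

(* The sign of [x], except at the two ends [k = 0] and [k = n], where it is
   prescribed because [x] may vanish there. *)
Definition grid_sign (n k : nat) (x : R) : bool :=
  (k != 0%N) && ((k == n) || (0 < x)).

Lemma weak_sign_grid_sign n k x : (k = 0%N -> x <= 0) -> (k = n -> 0 <= x) ->
  weak_sign (grid_sign n k x) x.
Proof.
rewrite /grid_sign; have [-> x0 _|k0 _] := eqVneq k 0%N; first exact: x0.
by have [-> /(_ erefl)|] := eqVneq k n; last by case: ltP => // /ltW.
Qed.

Definition grid_point (n i j : nat) : R * R := (i%:R / n%:R, j%:R / n%:R).

Lemma itv01_div (n k : nat) : (k <= n)%N -> I01 (k%:R / n%:R).
Proof.
case: n => [|n] kn; rewrite /= in_itv /= ?invr0 ?mulr0 ?lexx ?ler01 //.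
by rewrite divr_ge0 //= ler_pdivrMr // mul1r ler_nat.
Qed.

Lemma square_grid_point n i j : (i <= n)%N -> (j <= n)%N ->
  square (grid_point n i j).
Proof. by split; apply: itv01_div. Qed.

Lemma ball_grid_point n i j (a b : bool) (r : R) : n%:R^-1 < r ->
  ball (grid_point n i j) r (grid_point n (a + i) (b + j)).
Proof.
move=> nr; have dist (c : bool) (k : nat) :
    `|k%:R / n%:R - (c + k)%:R / n%:R| < r :> R.
  rewrite -mulrBl natrD opprD addrCA subrr addr0 normrM normrN.
  rewrite [`|n%:R^-1|]ger0_norm ?invr_ge0 //; apply: le_lt_trans nr.
  by rewrite ler_piMl ?invr_ge0 //; case: c; rewrite ?normr0 ?normr1.
by split; apply: dist.
Qed.

Lemma square_sign_changes (G : bool -> R * R -> R) (r : R) : 0 < r ->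
  (forall (k c : bool) x, square x ->
     (if k then x.2 else x.1) = c%:R -> weak_sign c (G k x)) ->
  exists2 x, square x &
    forall k c, exists2 y, square y /\ weak_sign c (G k y) & ball x r y.
Proof.
move=> r0 border.
have [n n_r] : exists n, n.+1%:R^-1 < r.
  by have [n] := ltr_add_invr r0; rewrite add0r; exists n.
pose x i j := grid_point n.+1 i j.
pose label k i j := grid_sign n.+1 (if k then j else i) (G k (x i j)).
have sign_label k i j : (i <= n.+1)%N -> (j <= n.+1)%N ->
    weak_sign (label k i j) (G k (x i j)).
  move=> lin ljn; have sq_x := square_grid_point lin ljn.
  apply: weak_sign_grid_sign => [coord0|coord1].
    by apply: (border k false) => //; case: k coord0 => /= ->; rewrite mul0r.
  apply: (border k true) => //.
  by case: k coord1 => /= ->; rewrite divff ?pnatr_eq0.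
have [||||i [j [lin ljn nA nB]]] :=
  @grid_nonconstant_cell (label false) (label true) n.+1.
- by [].
- by move=> j _; rewrite /label /grid_sign /= eqxx.
- by [].
- by move=> i _; rewrite /label /grid_sign /= eqxx.
exists (x i j) => [|k c]; first by apply: square_grid_point; apply: ltnW.
have [a [b <-]] : exists a b : bool, label k (a + i)%N (b + j)%N = c.
  by case: k; apply: nonconstant_on_cell.
have lai : (a + i <= n.+1)%N by case: (a); rewrite ?add0n // ltnW.
have lbj : (b + j <= n.+1)%N by case: (b); rewrite ?add0n // ltnW.
exists (x (a + i)%N (b + j)%N); last exact: ball_grid_point.
by split; [apply: square_grid_point | apply: sign_label].
Qed.

Lemma poincare_miranda (G1 G2 : R * R -> R) :
  {within square, continuous G1} -> {within square, continuous G2} ->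
  (forall t, I01 t -> G1 (0, t) <= 0) -> (forall t, I01 t -> 0 <= G1 (1, t)) ->
  (forall s, I01 s -> G2 (s, 0) <= 0) -> (forall s, I01 s -> 0 <= G2 (s, 1)) ->
  exists2 x, square x & G1 x = 0 /\ G2 x = 0.
Proof.
move=> cG1 cG2 G1l G1r G2b G2t.
have compact_square : compact square.
  by apply: compact_setX; apply: segment_compact.
pose G (k : bool) := if k then G2 else G1.
pose C (kc : bool * bool) := square `&` G kc.1 @^-1` [set x | weak_sign kc.2 x].
have [||r r0|x sq_x Cx] := @compact_near_closed_family (R * R)%type _ square C.
- by [].
- move=> [k c]; apply: within_continuous_closed; last exact: closed_weak_sign.
    by apply: compact_closed => //; apply: norm_hausdorff.
  by case: k.
- have [||x sq_x near_x] := @square_sign_changes G r; first by [].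
    move=> [] [] [s t] [/= Is It] /= ->;
      [exact: G2t | exact: G2b | exact: G1r | exact: G1l].
  by exists x => // -[k c]; apply: near_x.
exists x => //; split; apply: weak_sign_eq0 => c.
  by have [_] := Cx (false, c).
by have [_] := Cx (true, c).
Qed.

End PoincareMiranda.

(** * Arcs in the disk *)

Section Arcs.
Local Open Scope ring_scope.
Local Open Scope classical_set_scope.
Variable R : realType.
Implicit Types p q r x y z : R * R.
Local Notation I01 := (`[0, 1] : set R).

Lemma circle_disk p : on_unit_circle p -> in_unit_disk p.
Proof. by rewrite /in_unit_disk => ->. Qed.

(* The distance from [x] to the tangent of the circle at [p]. *)
Definition depth p x : R := 1 - (p.1 * x.1 + p.2 * x.2).

Lemma depthE p x : on_unit_circle p ->
  depth p x =
    (1 - (x.1 ^+ 2 + x.2 ^+ 2) + (p.1 - x.1) ^+ 2 + (p.2 - x.2) ^+ 2) / 2.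
Proof. by rewrite /on_unit_circle /depth => cp; lra. Qed.

Lemma depth_ge0 p x : on_unit_circle p -> in_unit_disk x -> 0 <= depth p x.
Proof.
move=> cp dx; rewrite depthE // divr_ge0 // addr_ge0 ?sqr_ge0 //.
by rewrite addr_ge0 ?sqr_ge0 // subr_ge0.
Qed.

Lemma depth_eq0 p x : on_unit_circle p -> in_unit_disk x ->
  (depth p x == 0) = (p == x).
Proof.
move=> cp dx; apply/eqP/eqP => [|<-]; last by rewrite /depth -!expr2 cp subrr.
rewrite depthE // => depth0; have dist : 0 <= 1 - (x.1 ^+ 2 + x.2 ^+ 2).
  by rewrite subr_ge0.
have := sqr_ge0 (p.1 - x.1); have := sqr_ge0 (p.2 - x.2) => sq2 sq1.
have /eqP : (p.1 - x.1) ^+ 2 = 0 by lra.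
have /eqP : (p.2 - x.2) ^+ 2 = 0 by lra.
rewrite !sqrf_eq0 !subr_eq0 => /eqP px2 /eqP px1.
by rewrite [p]surjective_pairing px1 px2 -surjective_pairing.
Qed.

Lemma depth_self p : on_unit_circle p -> depth p p = 0.
Proof. by move=> cp; apply/eqP; rewrite depth_eq0 //; apply: circle_disk. Qed.

Lemma depth_gt0 p x : on_unit_circle p -> in_unit_disk x -> p != x ->
  0 < depth p x.
Proof. by move=> cp dx px; rewrite lt_def depth_eq0 // px depth_ge0. Qed.

Definition orient p q r : R :=
  (q.1 - p.1) * (r.2 - p.2) - (q.2 - p.2) * (r.1 - p.1).

Lemma depth_scale_inj p q r x y (a b : R) : orient p q r != 0 -> a != 0 ->
  (forall w, w \in [:: p; q; r] -> a * depth w x = b * depth w y) -> x = y.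
Proof.
move=> o0 a0 scale.
pose u := (a * x.1 - b * y.1, a * x.2 - b * y.2).
pose dot w := w.1 * u.1 + w.2 * u.2.
have dotE w : w \in [:: p; q; r] -> dot w = a - b.
  by move=> /scale; rewrite /dot /depth /u /=; lra.
have u1 : u.1 = 0.
  apply: (mulfI o0); rewrite mulr0.
  transitivity ((r.2 - p.2) * (dot q - dot p) - (q.2 - p.2) * (dot r - dot p)).
    by rewrite /orient /dot; ring.
  by rewrite !dotE ?inE ?eqxx ?orbT // subrr !mulr0 subrr.
have u2 : u.2 = 0.
  apply: (mulfI o0); rewrite mulr0.
  transitivity ((q.1 - p.1) * (dot r - dot p) - (r.1 - p.1) * (dot q - dot p)).
    by rewrite /orient /dot; ring.
  by rewrite !dotE ?inE ?eqxx ?orbT // subrr !mulr0 subrr.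
have ab : a = b.
  apply/eqP; rewrite -subr_eq0 -(dotE p) ?inE ?eqxx //.
  by rewrite /dot u1 u2 !mulr0 addr0.
rewrite [x]surjective_pairing [y]surjective_pairing; congr pair;
  apply: (mulfI a0); apply/subr0_eq; rewrite [in X in _ - X]ab;
  [exact: u1 | exact: u2].
Qed.

(* It vanishes iff [x] and [y] are on a line through the pole of the chord
   [pq]. *)
Definition depth_gap p q x y : R :=
  depth p x * depth q y - depth p y * depth q x.

Lemma depth_gapC p q x y : depth_gap q p x y = - depth_gap p q x y.
Proof. by rewrite /depth_gap; ring. Qed.

Lemma depth_gap_scale p q x y (a b : R) :
  depth_gap p q x y = 0 ->
  (a * depth p y + b * depth q y) * depth p x =
  (a * depth p x + b * depth q x) * depth p y.
Proof.
move=> /subr0_eq gap; rewrite !mulrDl -!mulrA [depth q y * _]mulrC gap; ring.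
Qed.

Lemma depth_gap_inj p1 p2 p3 p4 x y :
  on_unit_circle p1 -> on_unit_circle p3 -> in_unit_disk x -> in_unit_disk y ->
  0 < orient p1 p2 p3 -> 0 < orient p1 p2 p4 ->
  0 < orient p1 p3 p4 -> 0 < orient p2 p3 p4 ->
  depth_gap p1 p3 x y = 0 -> depth_gap p2 p4 x y = 0 -> x = y.
Proof.
move=> c1 c3 dx dy o123 o124 o134 o234 gap13 gap24.
pose weight w := orient p2 p3 p4 * depth p1 w + orient p1 p2 p4 * depth p3 w.
have weight_gt0 w : in_unit_disk w -> 0 < weight w.
  move=> dw; have [w3|w3] := eqVneq p3 w.
    apply: ltr_pwDl; last by rewrite mulr_ge0 ?(ltW o124) ?depth_ge0.
    rewrite mulr_gt0 // depth_gt0 // -w3; apply: contraTneq o123 => ->.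
    by rewrite /orient; lra.
  by rewrite ltr_wpDl ?mulr_gt0 ?depth_gt0 // mulr_ge0 ?(ltW o234) ?depth_ge0.
(* The affine dependency between the four points gives a second expression of
   the weight. *)
have weightE w : weight w =
    orient p1 p3 p4 * depth p2 w + orient p1 p2 p3 * depth p4 w.
  by rewrite /weight /orient /depth; ring.
apply: (@depth_scale_inj p1 p2 p3 x y (weight y) (weight x)).
- by rewrite gt_eqF.
- by rewrite gt_eqF // weight_gt0.
move=> w; rewrite !inE => /or3P[] /eqP->.
- exact: depth_gap_scale.
- by rewrite !weightE; apply: depth_gap_scale.
- by rewrite /weight ![_ * depth p1 _ + _]addrC; apply: depth_gap_scale;
    rewrite depth_gapC gap13 oppr0.
Qed.

Lemma continuous_depth_gap p q :
  continuous (fun xy : (R * R) * (R * R) => depth_gap p q xy.1 xy.2).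
Proof.
have depth_cvg r (F : (R * R) * (R * R) -> R * R) w :
    {for w, continuous F} -> {for w, continuous (fun v => depth r (F v))}.
  move=> cF; apply: cvgB; first exact: cvg_cst.
  apply: cvgD; apply: cvgM; try exact: cvg_cst.
    by apply: cvg_comp cF _; apply: cvg_fst.
  by apply: cvg_comp cF _; apply: cvg_snd.
move=> w; have depth1 r := depth_cvg r fst w cvg_fst.
have depth2 r := depth_cvg r snd w cvg_snd.
apply: cvgB; apply: cvgM;
  [exact: depth1 | exact: depth2 | exact: depth2 | exact: depth1].
Qed.

Lemma within_continuous_prod (M N P Q : topologicalType) (A : set M) (B : set N)
    (f : M -> P) (g : N -> Q) :
  {within A, continuous f} -> {within B, continuous g} ->
  {within A `*` B, continuous (fun w => (f w.1, g w.2))}.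
Proof.
move=> /subspace_continuousP cf /subspace_continuousP cg.
apply/subspace_continuousP => -[s t] [/= As Bt].
have fst_within : fst @ within (A `*` B) (nbhs (s, t)) --> within A (nbhs s).
  move=> U AU; have AU_near : \forall w \near (s, t), A w.1 -> U w.1.
    exact: (@cvg_fst _ _ (nbhs s) (nbhs t) _ _ AU).
  by apply: filterS AU_near => w AU_w [Aw _]; apply: AU_w.
have snd_within : snd @ within (A `*` B) (nbhs (s, t)) --> within B (nbhs t).
  move=> U BU; have BU_near : \forall w \near (s, t), B w.2 -> U w.2.
    exact: (@cvg_snd _ _ (nbhs s) (nbhs t) _ _ BU).
  by apply: filterS BU_near => w BU_w [_ Bw]; apply: BU_w.
by apply: cvg_pair; [exact: cvg_comp fst_within (cf s As)
                    | exact: cvg_comp snd_within (cg t Bt)].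
Qed.

Lemma arcs_meet p1 p2 p3 p4 (A B : set (R * R)) :
  on_unit_circle p1 -> on_unit_circle p2 ->
  on_unit_circle p3 -> on_unit_circle p4 ->
  0 < orient p1 p2 p3 -> 0 < orient p1 p2 p4 ->
  0 < orient p1 p3 p4 -> 0 < orient p2 p3 p4 ->
  simple_arc p1 p3 A -> simple_arc p2 p4 B ->
  A `<=` @in_unit_disk R -> B `<=` @in_unit_disk R -> A `&` B !=set0.
Proof.
move=> c1 c2 c3 c4 o123 o124 o134 o234.
move=> [f [cf _ f0 f1 ->]] [g [cg _ g0 g1 ->]] dA dB.
have df s : I01 s -> in_unit_disk (f s) by move=> Is; apply: dA; exists s.
have dg s : I01 s -> in_unit_disk (g s) by move=> Is; apply: dB; exists s.
have gap_continuous p q : {within I01 `*` I01,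
    continuous (fun w => depth_gap p q (f w.1) (g w.2))}.
  apply: (@within_continuous_comp _ _ _ _ (fun w => (f w.1, g w.2))
    (fun xy => depth_gap p q xy.1 xy.2)); last exact: within_continuous_prod.
  by move=> xy _; apply: continuous_depth_gap.
have [||||[s t] [/= Is It] [gap13 gap42]] :=
  poincare_miranda (gap_continuous p1 p3) (gap_continuous p4 p2).
- move=> t It; rewrite /= f0 /depth_gap depth_self // mul0r sub0r oppr_le0.
  by rewrite mulr_ge0 // depth_ge0 //; [apply: dg | apply: circle_disk].
- move=> t It; rewrite /= f1 /depth_gap (depth_self c3) mulr0 subr0.
  by rewrite mulr_ge0 // depth_ge0 //; [apply: circle_disk | apply: dg].
- move=> s Is; rewrite /= g0 /depth_gap (depth_self c2) mulr0 sub0r oppr_le0.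
  by rewrite mulr_ge0 // depth_ge0 //; [apply: circle_disk | apply: df].
- move=> s Is; rewrite /= g1 /depth_gap (depth_self c4) mul0r subr0.
  by rewrite mulr_ge0 // depth_ge0 //; [apply: df | apply: circle_disk].
exists (f s); split; first by exists s.
exists t => //; apply/esym.
apply: (depth_gap_inj c1 c3 (df s Is) (dg t It) o123 o124 o134 o234 gap13).
by rewrite depth_gapC gap42 oppr0.
Qed.

Lemma addr1_sqr_gt0 (t : R) : 0 < 1 + t ^+ 2.
Proof. by rewrite ltr_pwDl ?sqr_ge0. Qed.

(* Stereographic coordinate from [z]; it increases counterclockwise, from
   [-oo] to [+oo], as the point runs through the circle without [z]. *)
Definition stereo z p : R := (z.2 * p.1 - z.1 * p.2) / depth z p.

Definition unstereo z (t : R) : R * R :=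
  (z.1 - (z.1 - t * z.2) * (2 / (1 + t ^+ 2)),
   z.2 - (z.2 + t * z.1) * (2 / (1 + t ^+ 2))).

Lemma depth_stereo z p : on_unit_circle z -> on_unit_circle p -> z != p ->
  2 / (1 + stereo z p ^+ 2) = depth z p.
Proof.
move=> cz cp zp; have d0 : depth z p != 0.
  by rewrite depth_eq0 //; apply: circle_disk.
apply/(canLR (mulfK _)); first by rewrite gt_eqF ?addr1_sqr_gt0.
apply: (mulfI d0); rewrite [RHS]mulrA -expr2 [RHS]mulrDr mulr1 -exprMn.
rewrite [depth z p * stereo z p]mulrC /stereo divfK //.
transitivity ((z.1 ^+ 2 + z.2 ^+ 2) * (p.1 ^+ 2 + p.2 ^+ 2) - 1 + 2 * depth z p).
  by rewrite cz cp mulr1 subrr add0r mulrC.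
by rewrite /depth; ring.
Qed.

Lemma stereoK z p : on_unit_circle z -> on_unit_circle p -> z != p ->
  unstereo z (stereo z p) = p.
Proof.
move=> cz cp zp; have d0 : depth z p != 0.
  by rewrite depth_eq0 //; apply: circle_disk.
have td : stereo z p * depth z p = z.2 * p.1 - z.1 * p.2.
  by rewrite /stereo divfK.
transitivity (z.1 * (1 - depth z p) + z.2 * (stereo z p * depth z p),
              z.2 * (1 - depth z p) - z.1 * (stereo z p * depth z p)).
  by rewrite /unstereo depth_stereo //; congr pair; ring.
transitivity (p.1 * (z.1 ^+ 2 + z.2 ^+ 2), p.2 * (z.1 ^+ 2 + z.2 ^+ 2)).
  by rewrite td /depth; congr pair; ring.
by rewrite cz !mulr1 -surjective_pairing.
Qed.

Lemma orient_unstereo z (a b c : R) :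
  orient (unstereo z a) (unstereo z b) (unstereo z c) =
    (z.1 ^+ 2 + z.2 ^+ 2) * (4 * ((b - a) * (c - a) * (c - b)) /
      ((1 + a ^+ 2) * (1 + b ^+ 2) * (1 + c ^+ 2))).
Proof.
by rewrite /orient /unstereo /=; field; rewrite !gt_eqF ?addr1_sqr_gt0.
Qed.

Lemma orient_pole_unstereo z (a b : R) :
  orient z (unstereo z a) (unstereo z b) =
    (z.1 ^+ 2 + z.2 ^+ 2) * (4 * (b - a) / ((1 + a ^+ 2) * (1 + b ^+ 2))).
Proof.
by rewrite /orient /unstereo /=; field; rewrite !gt_eqF ?addr1_sqr_gt0.
Qed.

End Arcs.

(** * Circular order of a drawing *)

Section Chords.
Variables (T : finType) (e : rel T) (n : nat) (v : nat -> T).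

Definition chord (i j : nat) : bool := [&& i < j, j < n & e (v i) (v j)].

Definition interleaved (i j k l : nat) : bool :=
  [&& i < k, k < j & j < l] || [&& k < i, i < l & l < j].

Definition singly_crossed : Prop := forall i j k l k' l',
  chord i j -> chord k l -> chord k' l' ->
  interleaved i j k l -> interleaved i j k' l' -> k = k' /\ l = l'.

End Chords.

Section CircularOrder.
Variables (R : realType) (T : finType) (S : {set T}) (z : T) (pos : T -> R * R).
Hypothesis zS : z \in S.
Hypothesis pos_on_circle : {in S, forall x, on_unit_circle (pos x)}.
Hypothesis pos_inj_in : {in S &, injective pos}.
Local Notation angle x := (stereo (pos z) (pos x)).

Definition circular_seq : seq T :=
  z :: sort (fun x y => angle x <= angle y)%R (enum (S :\ z)).

Local Notation v := (nth z circular_seq).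

Lemma mem_circular_seq : circular_seq =i S.
Proof.
move=> x; rewrite inE mem_sort mem_enum in_setD1.
by case: eqP => [->|]; rewrite ?zS.
Qed.

Lemma uniq_circular_seq : uniq circular_seq.
Proof. by rewrite /= mem_sort mem_enum in_setD1 eqxx sort_uniq enum_uniq. Qed.

Lemma size_circular_seq : size circular_seq = #|S|.
Proof.
by rewrite -(card_uniqP uniq_circular_seq); apply: eq_card mem_circular_seq.
Qed.

Lemma nth_circular_seq_in i : i < #|S| -> v i \in S.
Proof. by move=> iS; rewrite -mem_circular_seq mem_nth ?size_circular_seq. Qed.

Lemma eq_nth_circular_seq i j : i < #|S| -> j < #|S| -> (v i == v j) = (i == j).
Proof.
by move=> iS jS; rewrite nth_uniq ?size_circular_seq ?uniq_circular_seq.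
Qed.

Lemma nth_circular_seq_neq0 i : 0 < i < #|S| -> v i != z.
Proof.
move=> /andP[i0 iS]; rewrite -[z]/(v 0) eq_nth_circular_seq ?gtn_eqF //.
exact: ltn_trans i0 iS.
Qed.

Lemma pos_nth_circular_seq i : 0 < i < #|S| ->
  pos (v i) = unstereo (pos z) (angle (v i)).
Proof.
move=> iS; have viS : v i \in S by apply: nth_circular_seq_in; case/andP: iS.
apply/esym/stereoK; [exact: pos_on_circle | exact: pos_on_circle |].
by apply: contraNneq (nth_circular_seq_neq0 iS) => /(pos_inj_in zS viS)<-.
Qed.

Lemma angle_circular_seq i j : 0 < i -> i < j -> j < #|S| ->
  (angle (v i) < angle (v j))%R.
Proof.
move=> i0 ij jS; have iS := ltn_trans ij jS; have j0 := ltn_trans i0 ij.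
rewrite lt_neqAle; apply/andP; split.
  apply: contraTneq ij => angle_ij; have: pos (v i) = pos (v j).
    by rewrite pos_nth_circular_seq ?i0 // angle_ij -pos_nth_circular_seq ?j0.
  move/(pos_inj_in (nth_circular_seq_in iS) (nth_circular_seq_in jS))/eqP.
  by rewrite eq_nth_circular_seq // => /eqP->; rewrite ltnn.
case: i i0 ij iS => // i _ ij iS; case: j j0 ij jS => // j _ ij jS /=.
have angle_trans : transitive (fun x y => angle x <= angle y)%R.
  by move=> y x w; apply: le_trans.
apply: (sorted_ltn_nth angle_trans) => //.
- by apply: sort_sorted => x y; apply: le_total.
- by rewrite inE -ltnS -[X in _ < X]/(size circular_seq) size_circular_seq.
- by rewrite inE -ltnS -[X in _ < X]/(size circular_seq) size_circular_seq.
Qed.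

Lemma orient_circular_seq i j k : i < j -> j < k -> k < #|S| ->
  (0 < orient (pos (v i)) (pos (v j)) (pos (v k)))%R.
Proof.
move=> ij jk kS; have jS := ltn_trans jk kS; have iS := ltn_trans ij jS.
have j_in : 0 < j < #|S| by lia.
have k_in : 0 < k < #|S| by lia.
rewrite [pos (v j)]pos_nth_circular_seq // [pos (v k)]pos_nth_circular_seq //.
have [i0|i0] := posnP i.
  rewrite i0 orient_pole_unstereo pos_on_circle // mul1r.
  by rewrite divr_gt0 ?mulr_gt0 ?addr1_sqr_gt0 // subr_gt0 angle_circular_seq //; lia.
rewrite pos_nth_circular_seq ?i0 // orient_unstereo pos_on_circle // mul1r.
by rewrite divr_gt0 ?mulr_gt0 ?addr1_sqr_gt0 // subr_gt0 angle_circular_seq //; lia.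
Qed.

Variables (e : rel T) (curve : {set T} -> set (R * R)).
Hypothesis drawing : circle_drawing e S pos curve.

Lemma chord_edges_in i j : chord e #|S| v i j ->
  [set v i; v j] \in edges_in e S.
Proof.
move=> /and3P[ij jS e_ij]; apply/imset2P.
by exists (v i) (v j); rewrite ?inE ?nth_circular_seq_in //; lia.
Qed.

Lemma interleaved_arcs_meet i j k l : i < k -> k < j -> j < l ->
  chord e #|S| v i j -> chord e #|S| v k l ->
  (curve [set v i; v j] `&` curve [set v k; v l] !=set0)%classic.
Proof.
move=> ik kj jl chord_ij chord_kl.
have [_ jS e_ij] := and3P chord_ij; have [kl lS e_kl] := and3P chord_kl.
have kS := ltn_trans kl lS; have iS := ltn_trans ik kS.
have vS := nth_circular_seq_in.
apply: (@arcs_meet R (pos (v i)) (pos (v k)) (pos (v j)) (pos (v l))).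
1-4: exact/pos_on_circle/vS.
1-4: by apply: orient_circular_seq; lia.
1-2: by apply: (curve_arc drawing) => //; apply: vS.
all: by apply: (curve_disk drawing); apply: chord_edges_in.
Qed.

Lemma interleaved_crosses i j k l :
  chord e #|S| v i j -> chord e #|S| v k l -> interleaved i j k l ->
  crosses S pos curve [set v i; v j] [set v k; v l].
Proof.
move=> chord_ij chord_kl ijkl.
have [ij jS _] := and3P chord_ij; have [kl lS _] := and3P chord_kl.
have disjoint_ends w : w \in [set v i; v j] -> w \in [set v k; v l] -> False.
  rewrite !inE => /orP[]/eqP-> /orP[]; rewrite eq_nth_circular_seq; move: ijkl;
    rewrite /interleaved; lia.
split=> [same_edge|].
  by apply: (disjoint_ends (v i)); rewrite -?same_edge !inE eqxx.
have [x [ij_x kl_x]] :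
    (curve [set v i; v j] `&` curve [set v k; v l] !=set0)%classic.
  case/orP: ijkl => /and3P[lt1 lt2 lt3]; first exact: interleaved_arcs_meet.
  by rewrite classical_sets.setIC; apply: interleaved_arcs_meet.
exists x; split=> // w wS wx; rewrite -wx in ij_x kl_x.
by apply: (disjoint_ends w); apply: (curve_vertex drawing) => //;
  apply: chord_edges_in.
Qed.

Lemma drawing_singly_crossed :
  {in edges_in e S & &, forall E F F', crosses S pos curve E F ->
     crosses S pos curve E F' -> F = F'} ->
  singly_crossed e #|S| v.
Proof.
move=> crossed_once i j k l k' l' chord_ij chord_kl chord_kl' cross cross'.
have /setP same_ends := crossed_once _ _ _ (chord_edges_in chord_ij)
  (chord_edges_in chord_kl) (chord_edges_in chord_kl')
  (interleaved_crosses chord_ij chord_kl cross)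
  (interleaved_crosses chord_ij chord_kl' cross').
have [kl lS _] := and3P chord_kl; have [kl' lS' _] := and3P chord_kl'.
have kS := ltn_trans kl lS; have kS' := ltn_trans kl' lS'.
have := same_ends (v k); have := same_ends (v l).
have := same_ends (v k'); have := same_ends (v l').
by rewrite !inE !eq_nth_circular_seq // !eqxx ?orbT; clear -kl kl'; lia.
Qed.

End CircularOrder.

(** * Small intervals *)

Section Sides.
Variables (T : finType) (e : rel T).
Hypothesis e_sym : symmetric e.
Local Notation d := (deg e).

Lemma deg_le_size x (L : seq T) : (forall y, e x y -> y \in L) -> d x <= size L.
Proof.
move=> adjL; apply: leq_trans (card_size L).
by apply: subset_leq_card; apply/subsetP => y; rewrite inE => /adjL.
Qed.

Lemma deg_ge_size_adj x (L : seq T) : (forall y, e x y -> y \in L) ->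
  size L <= d x -> {in L, forall y, e x y}.
Proof.
move=> adjL le_L y yL.
have sub : [set y | e x y] \subset [set y in L].
  by apply/subsetP => w; rewrite !inE => /adjL.
have: [set y | e x y] == [set y in L].
  by rewrite eqEcard sub (leq_trans _ le_L) // cardsE card_size.
by move/eqP/setP/(_ y); rewrite !inE yL.
Qed.

Definition reducible : Prop :=
  config_a e \/ config_b e \/ config_c e \/ config_d e \/
  config_e e \/ config_f e \/ config_g e.

Lemma deg2_reducible u w : d u = 2 -> e w u -> d w <= 4 -> reducible.
Proof. by move=> du wu dw; left; exists u, w; rewrite e_sym. Qed.

Lemma diamond_reducible4 o p w q : diamond e o p w q -> d w <= 4 -> reducible.
Proof. by move=> D dw; do 3! right; left; exists o, p, w, q. Qed.

Lemma diamond_reducible_deg2 o p w q u :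
  diamond e o p w q -> e w u -> d u = 2 -> reducible.
Proof. by move=> D wu du; do 4! right; left; exists o, p, w, q, u. Qed.

Lemma diamond_reducible_diamond o p w q o' p' q' :
  diamond e o p w q -> diamond e o' p' w q' ->
  uniq (w :: [:: o; p; q] ++ [:: o'; p'; q']) -> reducible.
Proof.
move=> D [/andP[/and5P[_ p'w wq' _ _] _] p'q' dp' _].
rewrite -[w :: _]/([:: w] ++ [:: o; p] ++ [:: q; o'; p'; q']) uniq_catCA.
move=> /mask_uniq/(_ [:: true; true; true; true; false; true; true]) uniq_opwqp'q'.
by do 5! right; left; exists o, p, w, q, p', q'; rewrite e_sym.
Qed.

Lemma diamond_reducible_triangle o p w q r : diamond e o p w q ->
  uniq [:: o; p; w; q; r] -> e o w -> e w r -> e o r -> reducible.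
Proof. by move=> D uniq_r ow wr e_or; do 6! right; exists o, p, w, q, r. Qed.

Lemma diamond_rev o p w q : diamond e o p w q -> diamond e w q o p.
Proof.
move=> [/andP[cyc_opwq uniq_opwq] pq dp dq]; split=> //; last by rewrite e_sym.
rewrite /ucycle -[[:: w; q; o; p]]/(rot 2 [:: o; p; w; q]).
by rewrite rot_cycle rot_uniq cyc_opwq.
Qed.

(* An interval of at most four vertices seen from its end [w]: [o] is its other
   end, and [L] lists the vertices of the interval other than [w]. *)
Variant side (w o : T) : seq T -> Prop :=
| SideEdge : side w o [:: o]
| SideEar u of d u = 2 & e w u : side w o [:: o; u]
| SideDiamond p q of diamond e o p w q : side w o [:: o; p; q].

Lemma diamond_reducible_adj o p w q r (L : seq T) : diamond e o p w q ->
  r \notin [:: o; p; w; q] -> (forall y, e w y -> y \in L) -> size L <= 5 ->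
  o \in L -> r \in L -> (4 < d w -> e o r) -> reducible.
Proof.
move=> D r_new adjL L5 oL rL e_or.
have uniq_opwqr : uniq [:: o; p; w; q; r].
  rewrite -[[:: o; p; w; q; r]]/(rcons [:: o; p; w; q] r) rcons_uniq r_new.
  by case: D => /andP[].
have [/(diamond_reducible4 D)//|dw] := leqP (d w) 4.
have adj_w := deg_ge_size_adj adjL (leq_trans L5 dw).
by apply: (diamond_reducible_triangle D uniq_opwqr _ (adj_w r rL) (e_or dw));
  rewrite e_sym adj_w.
Qed.

Lemma sides_reducible w i j Li Lj X : side w i Li -> side w j Lj ->
  (forall y, e w y -> y \in X ++ Li ++ Lj) -> uniq (w :: X ++ Li ++ Lj) ->
  size X <= 1 -> X = [::] \/ e i j ->
  [\/ reducible, size Li = 1 /\ size Lj = 1 |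
      [/\ size Li = 2, size Lj = 2, size X = 1, d w = 5 &
          {in X ++ Li ++ Lj, forall y, e w y}]].
Proof.
move=> sideLi sideLj adj_w uniq_w X1 Xij; have := deg_le_size adj_w.
rewrite size_cat => dw.
have {uniq_w} uniq_w : uniq (w :: Li ++ Lj).
  move: uniq_w; rewrite /= mem_cat negb_or cat_uniq.
  by case/and3P=> /andP[_ ->] _ /andP[_ ->].
have ij_of_deg : size (Li ++ Lj) <= 4 -> 4 < d w -> e i j.
  by case: Xij dw => [->|//] /=; lia.
case: sideLi sideLj adj_w uniq_w dw ij_of_deg
    => [|u du wu|p q D] [|u' du' wu'|p' q' D'] adj_w uniq_w dw ij.
- by constructor 2.
- by constructor 1; apply: (deg2_reducible du' wu'); move: dw => /=; lia.
- constructor 1; apply: (diamond_reducible_adj (r := i) D' _ adj_w).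
  + case/and3P: uniq_w; rewrite !inE !negb_or (eq_sym w).
    by move=> /andP[-> _] /and3P[-> -> ->].
  + by rewrite size_cat /=; lia.
  + by rewrite !mem_cat !inE eqxx ?orbT.
  + by rewrite !mem_cat !inE eqxx ?orbT.
  + by rewrite e_sym; apply: ij.
- by constructor 1; apply: (deg2_reducible du wu); move: dw => /=; lia.
- have [dw4|dw5] := leqP (d w) 4.
    by constructor 1; apply: (deg2_reducible du wu).
  have X_size : size X = 1 by move: dw => /=; lia.
  constructor 3; split=> //; first by move: dw => /=; lia.
  by apply: deg_ge_size_adj => //; rewrite size_cat X_size.
- by constructor 1; apply: (diamond_reducible_deg2 D' wu du).
- constructor 1; apply: (diamond_reducible_adj (r := j) D _ adj_w).
  + move: uniq_w; rewrite -[_ :: _]/(rcons [:: w; i; p; q] j) rcons_uniq.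
    by rewrite !inE !negb_or => /andP[/and4P[-> -> -> ->]].
  + by rewrite size_cat /=; lia.
  + by rewrite !mem_cat !inE eqxx ?orbT.
  + by rewrite !mem_cat !inE eqxx ?orbT.
  + exact: ij.
- by constructor 1; apply: (diamond_reducible_deg2 D wu' du').
- by constructor 1; apply: (diamond_reducible_diamond D D').
Qed.

Hypothesis min_deg : forall x, 2 <= d x.

Lemma adj_pair_deg2 u x y : (forall w, e u w -> w \in [:: x; y]) ->
  [/\ d u = 2, e u x & e u y].
Proof.
move=> adj_u; have d_u := min_deg u.
split; last 2 first.
- by apply: (deg_ge_size_adj adj_u); rewrite // !inE eqxx.
- by apply: (deg_ge_size_adj adj_u); rewrite // !inE eqxx orbT.
- by apply/eqP; rewrite eqn_leq d_u andbT (deg_le_size adj_u).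
Qed.

Lemma inner_pair_reducible_or_diamond o p w q : uniq [:: o; p; w; q] ->
  (forall y, e p y -> y \in [:: o; w; q]) ->
  (forall y, e q y -> y \in [:: o; w; p]) ->
  reducible \/ diamond e o p w q.
Proof.
move=> uniq_opwq adj_p adj_q; have [pq|npq] := boolP (e p q); last first.
  have [dp po pw] : [/\ d p = 2, e p o & e p w].
    apply: adj_pair_deg2 => y py; have := adj_p y py; rewrite !inE orbA.
    by case/orP=> // /eqP yq; rewrite -yq py in npq.
  have [dq qo qw] : [/\ d q = 2, e q o & e q w].
    apply: adj_pair_deg2 => y qy; have := adj_q y qy; rewrite !inE orbA.
    by case/orP=> // /eqP yp; rewrite e_sym -yp qy in npq.
  left; do 2! right; left; exists o, p, w, q; split=> //.
  by rewrite /ucycle uniq_opwq /= (e_sym o) po pw (e_sym w) qw qo.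
have := min_deg p; have := min_deg q.
rewrite leq_eqVlt => /predU1P[dq _|dq].
  left; apply: (deg2_reducible (esym dq) pq).
  by have := deg_le_size adj_p => /=; lia.
rewrite leq_eqVlt => /predU1P[dp|dp].
  left; apply: (deg2_reducible (w := q) (esym dp)); first by rewrite e_sym.
  by have := deg_le_size adj_q => /=; lia.
have adj_p_all := deg_ge_size_adj adj_p dp.
have adj_q_all := deg_ge_size_adj adj_q dq.
right; split=> //; last 2 first.
- by have := deg_le_size adj_p => /=; lia.
- by have := deg_le_size adj_q => /=; lia.
apply/andP; split=> //=.
by rewrite e_sym !adj_p_all 1?e_sym ?adj_q_all ?inE ?eqxx ?orbT.
Qed.

End Sides.

Lemma uniq_interval_cat i k j (X : seq nat) : i < k < j -> uniq X ->
  {in X, forall m, ~~ (i <= m <= j)} ->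
  uniq (k :: X ++ iota i (k - i) ++ rev (iota k.+1 (j - k))).
Proof.
move=> ikj uniqX Xout.
rewrite /= !mem_cat !cat_uniq uniqX mem_rev rev_uniq !iota_uniq !mem_iota.
have -> : (k \in X) = false by apply/negP => /Xout; lia.
apply/andP; split; first by lia.
apply/and5P; split=> //; last first.
  by apply/hasPn => m; rewrite mem_rev /= !mem_iota; lia.
apply/hasPn => m; rewrite mem_cat mem_rev !mem_iota => m_ij.
by apply/negP => /Xout; lia.
Qed.

Section Intervals.
Variables (T : finType) (e : rel T).
Hypotheses (e_sym : symmetric e) (e_irr : irreflexive e).
Hypothesis min_deg : forall x, 2 <= deg e x.
Local Notation d := (deg e).

(* [v 0, ..., v n.-1] are the vertices of an end block in circular order, the
   vertex at which the block may be attached to the rest being [v 0]. *)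
Variables (n : nat) (v : nat -> T).
Hypothesis v_inj : {in gtn n &, injective v}.
Hypothesis v_adj : forall k y, 0 < k < n -> e (v k) y ->
  exists2 m, m < n & y = v m.
Hypothesis v_crossing : singly_crossed e n v.
Local Notation adj i j := (e (v i) (v j)).

Lemma adj_neq i j : adj i j -> i <> j.
Proof. by move=> + ij; rewrite ij e_irr. Qed.

Lemma adj_in_map k (L : seq nat) : 0 < k < n ->
  (forall m, m < n -> adj k m -> m \in L) -> forall y, e (v k) y -> y \in map v L.
Proof.
move=> kn adjL y ky; have [m mn ym] := v_adj kn ky.
by rewrite ym map_f // adjL // -ym.
Qed.

Lemma uniq_map_v (L : seq nat) : all (gtn n) L -> uniq L -> uniq (map v L).
Proof.
move=> /allP Ln uniqL; rewrite map_inj_in_uniq // => x y /Ln xn /Ln yn.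
exact: v_inj.
Qed.

Definition closed_interval (i j : nat) : bool :=
  [forall k : 'I_n, forall m : 'I_n, (i < k < j) ==> adj k m ==> (i <= m <= j)].

Lemma closed_intervalP i j : j < n ->
  reflect (forall k m, i < k < j -> m < n -> adj k m -> i <= m <= j)
          (closed_interval i j).
Proof.
move=> jn; apply: (iffP forallP) => [closed_ij k m ikj mn km | closed_ij k].
  have kn : k < n by lia.
  by have /forallP/(_ (Ordinal mn))/implyP/(_ ikj)/implyP/(_ km) :=
    closed_ij (Ordinal kn).
by apply/forallP => m; apply/implyP => ikj; apply/implyP; apply: closed_ij.
Qed.

Lemma closed_ear i j : j = i.+2 -> j < n -> closed_interval i j ->
  [/\ d (v i.+1) = 2, adj i.+1 i & adj i.+1 j].
Proof.
move=> jE jn /(closed_intervalP _ jn) closed_ij; apply: (adj_pair_deg2 min_deg).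
apply: (@adj_in_map i.+1 [:: i; j]) => [|m mn im]; first by lia.
by have := closed_ij i.+1 m _ mn im; have := adj_neq im; rewrite !inE; lia.
Qed.

Definition diamond_at (i : nat) : Prop :=
  diamond e (v i) (v i.+1) (v i.+3) (v i.+2).

Lemma closed_diamond i : i.+3 < n -> closed_interval i i.+3 ->
  reducible e \/ diamond_at i.
Proof.
move=> lt_n /(closed_intervalP _ lt_n) closed_i.
apply: inner_pair_reducible_or_diamond => //.
- by apply: (@uniq_map_v [:: i; i.+1; i.+3; i.+2]) => /=; rewrite ?inE; lia.
- apply: (@adj_in_map i.+1 [:: i; i.+3; i.+2]) => [|m mn im]; first by lia.
  by have := closed_i i.+1 m _ mn im; have := adj_neq im; rewrite !inE; lia.
- apply: (@adj_in_map i.+2 [:: i; i.+3; i.+1]) => [|m mn im]; first by lia.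
  by have := closed_i i.+2 m _ mn im; have := adj_neq im; rewrite !inE; lia.
Qed.

Definition small_interval (i j : nat) : Prop :=
  closed_interval i j /\ [\/ j = i.+1, j = i.+2 | j = i.+3 /\ diamond_at i].

Lemma side_right i j : j < n -> small_interval i j ->
  side e (v j) (v i) (map v (iota i (j - i))).
Proof.
move=> jn [closed_ij [jE|jE|[jE D]]]; subst j.
- by rewrite subSnn; constructor.
- have [d2 _ u_adj] := closed_ear erefl jn closed_ij.
  have -> : i.+2 - i = 2 by lia.
  by apply: SideEar; rewrite // e_sym.
- have -> : i.+3 - i = 3 by lia.
  exact: SideDiamond.
Qed.

Lemma side_left i j : j < n -> small_interval i j ->
  side e (v i) (v j) (map v (rev (iota i.+1 (j - i)))).
Proof.
move=> jn [closed_ij [jE|jE|[jE D]]]; subst j.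
- by rewrite subSnn; constructor.
- have [d2 u_adj _] := closed_ear erefl jn closed_ij.
  have -> : i.+2 - i = 2 by lia.
  by apply: SideEar; rewrite // e_sym.
- have -> : i.+3 - i = 3 by lia.
  by apply: SideDiamond; apply: diamond_rev.
Qed.

Lemma small_intervals_reducible i k j (X : seq nat) :
  i < k < j -> j < n -> small_interval i k -> small_interval k j ->
  all (fun m => (m < n) && ~~ (i <= m <= j)) X -> uniq X -> size X <= 1 ->
  (forall m, m < n -> adj k m -> (m \in X) || (i <= m <= j)) ->
  X = [::] \/ adj i j ->
  [\/ reducible e, k = i.+1 /\ j = k.+1 |
      [/\ k = i.+2, j = k.+2, size X = 1, d (v k) = 5 & adj k i /\ adj k j]].
Proof.
move=> ikj jn small_ik small_kj /allP Xout uniqX X1 adj_k Xij.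
have kn : k < n by lia.
have := sides_reducible e_sym (X := map v X)
  (side_right kn small_ik) (side_left jn small_kj).
rewrite -!map_cat -map_cons !size_map size_rev !size_iota => sides.
have [|||||[ki jk]|[ki jk sizeX dk adj_all]] := sides.
- apply: adj_in_map => [|m mn km]; first by lia.
  rewrite !mem_cat mem_rev !mem_iota; have := adj_neq km; have := adj_k m mn km.
  by case: (m \in X) => //=; lia.
- apply: uniq_map_v; last by apply: uniq_interval_cat => // m /Xout/andP[].
  apply/allP => m; rewrite inE !mem_cat mem_rev !mem_iota.
  by case/or4P=> [|/Xout||] /=; lia.
- by [].
- by case: Xij => [->|]; [left | right].
- by constructor 1.
- by constructor 2; lia.
- constructor 3; split=> //; try lia.
  by split; apply/adj_all/map_f; rewrite !mem_cat mem_rev !mem_iota; lia.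
Qed.

Lemma three_ears_reducible a b c z : b = a.+2 -> c = b.+2 -> z = c.+2 -> z < n ->
  closed_interval a b -> closed_interval b c -> closed_interval c z ->
  adj a c -> adj b z -> adj b a -> adj b c -> adj c z ->
  d (v b) = 5 -> d (v c) = 5 -> reducible e.
Proof.
move=> ba cb zc zn; have [bn cn] : b < n /\ c < n by lia.
have uniq_path : uniq (map v [:: a; a.+1; b; b.+1; c; c.+1; z]).
  by apply: uniq_map_v => /=; rewrite ?inE; lia.
move=> closed_ab closed_bc closed_cz ac bz b_a bc cz db dc.
have [ab_d ab_a ab_b] := closed_ear ba bn closed_ab.
have [bc_d bc_b bc_c] := closed_ear cb cn closed_bc.
have [cz_d cz_c cz_z] := closed_ear zc zn closed_cz.
right; left; exists (v a), (v a.+1), (v b), (v b.+1), (v c), (v c.+1), (v z).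
split=> //; last by split; rewrite // e_sym.
by rewrite /= ab_b bc_c cz_z e_sym ab_a e_sym bc_b e_sym cz_c.
Qed.

Section Crossing.
Variables a b c z : nat.
Hypotheses (abcz : [&& a < b, b < c & c < z]) (zn : z < n).
Hypotheses (ac : adj a c) (bz : adj b z).

Lemma crossing_adj k m : k < n -> m < n -> adj k m ->
  (interleaved a c (minn k m) (maxn k m) -> minn k m = b /\ maxn k m = z) /\
  (interleaved b z (minn k m) (maxn k m) -> minn k m = a /\ maxn k m = c).
Proof.
move=> kn mn km; have ne := adj_neq km.
have chord_km : chord e n v (minn k m) (maxn k m).
  rewrite /chord; apply/and3P; split; try lia.
  by case: (ltngtP k m) ne => // _ _; rewrite e_sym.
have chord_ac : chord e n v a c by rewrite /chord ac; lia.
have chord_bz : chord e n v b z by rewrite /chord bz; lia.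
split=> cross.
  by apply: (v_crossing chord_ac) => //; rewrite /interleaved; lia.
by apply: (v_crossing chord_bz) => //; rewrite /interleaved; lia.
Qed.

Lemma crossing_closed : [&& closed_interval a z, closed_interval a b,
  closed_interval b c & closed_interval c z].
Proof.
have bn : b < n by lia.
have cn : c < n by lia.
apply/and4P; split; apply/closed_intervalP => // k m k_in mn km.
all: have kn : k < n by lia.
all: have := crossing_adj kn mn km; rewrite /interleaved; have := adj_neq km; lia.
Qed.

Lemma crossing_left_reducible : small_interval a b -> small_interval b c ->
  [\/ reducible e, b = a.+1 /\ c = b.+1 |
      [/\ b = a.+2, c = b.+2, d (v b) = 5, adj b a & adj b c]].
Proof.
move=> small_ab small_bc.
have [bn [cn abc]] : b < n /\ c < n /\ a < b < c by lia.
have adj_b m : m < n -> adj b m -> (m \in [:: z]) || (a <= m <= c).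
  move=> mn bm; have := crossing_adj bn mn bm.
  by rewrite /interleaved inE; have := adj_neq bm; lia.
have [|red|edges|[ba cb _ db [b_a b_c]]] :=
  small_intervals_reducible (X := [:: z]) abc cn
    small_ab small_bc _ isT isT adj_b (or_intror ac).
- by rewrite /= zn; lia.
- by constructor 1.
- by constructor 2.
- by constructor 3.
Qed.

Lemma crossing_right_reducible : small_interval b c -> small_interval c z ->
  [\/ reducible e, c = b.+1 /\ z = c.+1 |
      [/\ c = b.+2, z = c.+2, d (v c) = 5, adj c b & adj c z]].
Proof.
move=> small_bc small_cz.
have [an [cn bcz]] : a < n /\ c < n /\ b < c < z by lia.
have adj_c m : m < n -> adj c m -> (m \in [:: a]) || (b <= m <= z).
  move=> mn cm; have := crossing_adj cn mn cm.
  by rewrite /interleaved inE; have := adj_neq cm; lia.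
have [|red|edges|[cb zc _ dc [c_b c_z]]] :=
  small_intervals_reducible (X := [:: a]) bcz zn
    small_bc small_cz _ isT isT adj_c (or_intror bz).
- by rewrite /= an; lia.
- by constructor 1.
- by constructor 2.
- by constructor 3.
Qed.

Lemma crossing_small : small_interval a b -> small_interval b c ->
  small_interval c z -> reducible e \/ small_interval a z.
Proof.
move=> small_ab small_bc small_cz.
have [closed_az closed_ab closed_bc closed_cz] := and4P crossing_closed.
have [|[ba cb]|[ba cb db b_a b_c]] :=
  crossing_left_reducible small_ab small_bc.
- by left.
- have [|[_ zc]|[cb' _ _ _ _]] :=
    crossing_right_reducible small_bc small_cz.
  + by left.
  + have az : z = a.+3 by rewrite zc cb ba.
    have [] := @closed_diamond a; rewrite -?az //; first by left.
    by right; split=> //; constructor 3.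
  + by move: cb'; rewrite cb => /n_Sn.
- have [|[cb' _]|[_ zc dc _ c_z]] :=
    crossing_right_reducible small_bc small_cz.
  + by left.
  + by move: cb'; rewrite cb => /esym/n_Sn.
  + by left; apply: (@three_ears_reducible a b c z).
Qed.

End Crossing.

Lemma small_interval_join i w j : i < w < j -> j < n -> closed_interval i j ->
  small_interval i w -> small_interval w j -> reducible e \/ small_interval i j.
Proof.
move=> iwj jn closed_ij small_iw small_wj.
have adj_w m := closed_intervalP _ jn closed_ij w m iwj.
have [|[wi jw]|[]//] := small_intervals_reducible (X := [::]) iwj jn
  small_iw small_wj isT isT isT adj_w (or_introl erefl).
- by left.
- by right; split=> //; constructor 2; rewrite jw wi.
Qed.

Lemma closed_interval_split i j : i.+1 < j -> j < n -> closed_interval i j ->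
  (exists w, [/\ i < w < j, closed_interval i w & closed_interval w j]) \/
  (exists b c, [/\ [&& i < b, b < c & c < j], adj i c & adj b j]).
Proof.
move=> ij jn closed_ij; have inside := closed_intervalP _ jn closed_ij.
pose P w := (i < w < j) && closed_interval i w.
have exP : exists w, P w.
  exists i.+1; rewrite /P ltnSn ij /=.
  by apply/closed_intervalP => [|x m]; lia.
have P_le w : P w -> w <= j by rewrite /P; lia.
have [w /andP[iwj closed_iw] w_max] := ex_maxnP exP P_le.
have wn : w < n by lia.
have [/existsP[[c cn] /= /andP[wcj ic]]|/existsPn no_chord] :=
  boolP [exists c : 'I_n, (w < c < j) && adj i c].
  right; have : ~~ closed_interval i c.
    by apply/negP => closed_ic; have := w_max c; rewrite /P closed_ic; lia.
  case/forallPn => -[b bn] /forallPn[] [m mn] /=.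
  rewrite !negb_imply => /and3P[ibc bm m_out].
  have im : i <= m <= j by apply: (inside b) => //; lia.
  have ibcm : [&& i < b, b < c & c < m] by lia.
  have /and4P[closed_im _ _ _] := crossing_closed ibcm mn ic bm.
  have mj : m = j.
    have [mj|mj|//] := ltngtP m j; last by lia.
    by have := w_max m; rewrite /P closed_im; lia.
  by exists b, c; split; rewrite -?mj.
left; exists w; split=> //; apply/closed_intervalP => // x m wxj mn xm.
have im : i <= m <= j by apply: (inside x) => //; lia.
have [|mw] := leqP w m; first by lia.
rewrite e_sym in xm; have xn : x < n by lia.
have [lt_im|mi] := ltnP i m.
  by have := closed_intervalP _ wn closed_iw m x _ xn xm; lia.
have mE : m = i by lia.
by have := no_chord (Ordinal xn); rewrite /= -mE xm wxj.
Qed.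

Lemma closed_interval_small i j : i < j -> j < n -> closed_interval i j ->
  reducible e \/ small_interval i j.
Proof.
have [k] := ubnP (j - i); elim: k i j => // k IH i j lek ij jn closed_ij.
have small p q : [&& i <= p, p < q & q <= j] -> q - p < j - i ->
    closed_interval p q -> reducible e \/ small_interval p q.
  by move=> ipqj lt; apply: IH; lia.
have [ji|i1j] := leqP j i.+1; first by right; split=> //; constructor 1; lia.
have [[w [iwj closed_iw closed_wj]]|[b [c [ibcj ic bj]]]] :=
  closed_interval_split i1j jn closed_ij.
  have [||//|red|small_iw] := small i w; try lia; first by left.
  have [||//|red|small_wj] := small w j; try lia; first by left.
  exact: (small_interval_join iwj).
have /and4P[_ closed_ib closed_bc closed_cj] := crossing_closed ibcj jn ic bj.
have [||//|red|small_ib] := small i b; try lia; first by left.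
have [||//|red|small_bc] := small b c; try lia; first by left.
have [||//|red|small_cj] := small c j; try lia; first by left.
exact: (crossing_small ibcj jn ic bj).
Qed.

Lemma end_block_reducible : 1 < n -> reducible e.
Proof.
move=> n1.
have closed_all : closed_interval 0 n.-1.
  by apply/closed_intervalP => [|k m]; lia.
have [n1_gt0 n1_lt] : 0 < n.-1 /\ n.-1 < n by lia.
have [//|] := closed_interval_small n1_gt0 n1_lt closed_all.
have d_last : d (v n.-1) <= n.-1.
  rewrite -[leqRHS](size_iota 0) -(size_map v); apply: deg_le_size.
  apply: adj_in_map => [|m mn lm]; first by lia.
  by have := adj_neq lm; rewrite mem_iota; lia.
case=> _ [nE|nE|[nE D]]; rewrite nE in closed_all d_last.
- by have := min_deg (v 1); lia.
- have [|d1 _ e12] := closed_ear erefl _ closed_all; first by lia.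
  by apply: (deg2_reducible e_sym d1 (w := v 2)); [rewrite e_sym | lia].
- by apply: (diamond_reducible4 D); lia.
Qed.

End Intervals.

(** * End blocks *)

Section EndBlock.
Variables (T : finType) (e : rel T).
Hypotheses (e_sym : symmetric e) (e_irr : irreflexive e).

Lemma connect_induced_sym (A : {set T}) : connect_sym (induced e A).
Proof. by apply: sym_connect_sym => x y; rewrite /induced /= e_sym andbCA. Qed.

Lemma disconnected_in (A : {set T}) r : ~~ connected_in e A -> r \in A ->
  exists D : {set T}, [/\ D != set0, D \subset A, r \notin D &
    {in D & A, forall x y, e x y -> y \in D}].
Proof.
move=> ncA rA.
suff [y yA nry] : exists2 y, y \in A & ~~ connect (induced e A) y r.
  exists [set w in A | connect (induced e A) y w]; split.
  - by apply/set0Pn; exists y; rewrite inE yA connect0.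
  - by apply/subsetP => w; rewrite inE => /andP[].
  - by rewrite inE negb_and nry orbT.
  - move=> x w; rewrite !inE => /andP[xA yx] wA xw; rewrite wA.
    by apply: connect_trans yx (connect1 _); rewrite /induced /= xA wA.
apply/exists_inP; apply: contraR ncA => /exists_inPn to_r.
apply/forall_inP => x xA; apply/forall_inP => y yA.
have xr := negPn (to_r x xA); have yr := negPn (to_r y yA).
by apply: connect_trans xr _; rewrite connect_induced_sym.
Qed.

(* [C] is a union of components of the graph without [z]; a smallest such [C],
   over all [z], makes [z |: C] an end block. *)
Definition cut_off (z : T) (C : {set T}) : bool :=
  [&& z \notin C, C != set0 &
      [forall x in C, forall y, e x y ==> (y \in z |: C)]].

Lemma cut_offP z (C : {set T}) :
  reflect [/\ z \notin C, C != set0 &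
              forall x y, x \in C -> e x y -> y \in z |: C] (cut_off z C).
Proof.
apply: (iffP and3P) => -[zC C0 adjC]; split=> //.
  by move=> x y xC xy; have /forall_inP/(_ x xC)/forallP/(_ y)/implyP := adjC; apply.
by apply/forall_inP => x xC; apply/forallP => y; apply/implyP; apply: adjC.
Qed.

Lemma nonseparable_cut_off_block z (C : {set T}) : cut_off z C ->
  nonseparable e (z |: C) -> block e (z |: C).
Proof.
move=> /cut_offP[zC /set0Pn[c cC] adjC] nonsep; apply/maxsetP; split=> // B nonsepB CB.
apply/eqP; rewrite eqEsubset CB andbT; apply/subsetP => x xB; rewrite in_setU1.
have [//|xz] /= := eqVneq x z.
have zB : z \in B by rewrite (subsetP CB) ?setU11.
have cBz : c \in B :\ z.
  by rewrite in_setD1 (subsetP CB) ?setU1r // andbT; apply: contraNneq zC => <-.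
have xBz : x \in B :\ z by rewrite in_setD1 xz.
have /and3P[_ _ /forallP/(_ z)] := nonsepB.
rewrite negb_and negbK zB /= => /forall_inP/(_ c cBz)/forall_inP/(_ x xBz) cx.
have closedC : closed (induced e (B :\ z)) (mem C).
  apply: (intro_closed (connect_induced_sym _)) => p q.
  rewrite /induced /= !in_setD1 => /and3P[_ /andP[qz _] pq] pC.
  by have := adjC p q pC pq; rewrite in_setU1 (negPf qz).
by have := closed_connect closedC cx; rewrite /= cC.
Qed.

Hypothesis no_isolated : forall x, exists y, e x y.

Lemma cut_off_setD1 (D : {set T}) x : x \in D ->
  (forall u y, u \in D -> e u y -> y \in D) -> cut_off x (D :\ x).
Proof.
move=> xD adjD; apply/cut_offP; split; first by rewrite !inE eqxx.
  have [y xy] := no_isolated x; apply/set0Pn; exists y.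
  by rewrite in_setD1 (adjD x) // andbT; apply: contraTneq xy => ->; rewrite e_irr.
by move=> u y; rewrite setD1K // in_setD1 => /andP[_]; apply: adjD.
Qed.

Lemma exists_smallest_cut_off : 0 < #|T| -> exists z (C : {set T}),
  cut_off z C /\ forall z' C', cut_off z' C' -> #|C| <= #|C'|.
Proof.
case/card_gt0P => z0 _.
have cut_z0 : cut_off z0 ([set: T] :\ z0) by apply: cut_off_setD1.
pose zC := [arg min_(p < (z0, [set: T] :\ z0) | cut_off p.1 p.2) #|p.2|].
exists zC.1, zC.2; rewrite /zC; case: arg_minnP => //= -[z C] cutC minC.
by split=> // z' C' /(minC (z', C')).
Qed.

Section SmallestCutOff.
Variables (z : T) (C : {set T}).
Hypothesis cutC : cut_off z C.
Hypothesis smallestC : forall z' C', cut_off z' C' -> #|C| <= #|C'|.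

Lemma proper_not_cut_off w (D : {set T}) : D \proper C -> ~~ cut_off w D.
Proof. by move=> /proper_card; apply: contraTN => /smallestC; rewrite leqNgt. Qed.

Lemma smallest_cut_off_connected : connected_in e C.
Proof.
have /cut_offP[zC /set0Pn[c cC] adjC] := cutC.
apply/negPn/negP => /disconnected_in/(_ cC)[D [D0 DC cD adjD]].
have /(proper_not_cut_off z)/negP : D \proper C.
  by rewrite properE DC; apply/subsetPn; exists c.
apply; apply/cut_offP; split=> //; first by apply: contra zC; apply: (subsetP DC).
move=> x y xD xy; have := adjC x y (subsetP DC x xD) xy.
by rewrite !in_setU1 => /predU1P[->|/(adjD x y xD)->]; rewrite ?eqxx ?orbT.
Qed.

Lemma smallest_cut_off_setU1_connected : connected_in e (z |: C).
Proof.
have /cut_offP[zC _ adjC] := cutC.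
apply/negPn/negP => /disconnected_in/(_ (setU11 z C))[D [D0 DS zD adjD]].
have DC : D \subset C by rewrite -(setU1K zC) subsetD1 DS.
have adjD_all x y : x \in D -> e x y -> y \in D.
  by move=> xD xy; apply: (adjD x) => //; apply: (adjC x) => //; apply: (subsetP DC).
have [x xD] := set0Pn _ D0.
have /(proper_not_cut_off x)/negP := proper_sub_trans (properD1 xD) DC.
by apply; apply: cut_off_setD1.
Qed.

Lemma smallest_cut_off_nonseparable : nonseparable e (z |: C).
Proof.
have /cut_offP[zC _ adjC] := cutC.
apply/and3P; split; [|exact: smallest_cut_off_setU1_connected|].
  by apply/set0Pn; exists z; rewrite setU11.
apply/forallP => w; rewrite negb_and negbK; have [wS /=|//] := boolP (w \in z |: C).
have [->|wz] := eqVneq w z; first by rewrite setU1K // smallest_cut_off_connected.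
have zS : z \in (z |: C) :\ w by rewrite in_setD1 eq_sym wz setU11.
apply/negPn/negP => /disconnected_in/(_ zS)[D [D0 DS zD adjD]].
have [DzC wD] : D \subset z |: C /\ w \notin D.
  by apply/andP; rewrite -subsetD1.
have DC : D \subset C by rewrite -(setU1K zC) subsetD1 DzC.
have /(proper_not_cut_off w)/negP : D \proper C.
  rewrite properE DC; apply/subsetPn; exists w => //.
  by move: wS; rewrite in_setU1 (negPf wz).
apply; apply/cut_offP; split=> // x y xD xy; rewrite in_setU1.
have [//|yw] /= := eqVneq y w.
by apply: (adjD x) => //; rewrite in_setD1 yw (adjC x) // (subsetP DC).
Qed.

End SmallestCutOff.

Lemma exists_end_block : 0 < #|T| ->
  exists z, exists S : {set T}, [/\ block e S, z \in S, 1 < #|S| &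
    forall x y, x \in S -> x != z -> e x y -> y \in S].
Proof.
move=> /exists_smallest_cut_off[z [C [cutC smallestC]]].
have /cut_offP[zC C0 adjC] := cutC.
exists z, (z |: C); split; rewrite ?setU11 //.
- exact: nonseparable_cut_off_block (smallest_cut_off_nonseparable cutC smallestC).
- by rewrite cardsU1 zC ltnS card_gt0.
- by move=> x y /setU1P[->|xC]; [rewrite eqxx | move=> _; apply: adjC].
Qed.

End EndBlock.

Theorem theorem2p3 (R : realType) (T : finType) (e : rel T)
    (e_sym : symmetric e) (e_irr : irreflexive e) (T_nonempty : (0 < #|T|)%N)
    (e_pop : pseudo_outerplanar R e)
    (min_deg : forall x : T, (2 <= deg e x)%N) :
  config_a e \/ config_b e \/ config_c e \/ config_d e \/
  config_e e \/ config_f e \/ config_g e.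
Proof.
have no_isolated x : exists y, e x y.
  have /card_gt0P[y] : 0 < deg e x by apply: leq_trans (min_deg x).
  by rewrite inE; exists y.
have [z [S [blockS zS S1 adjS]]] := exists_end_block e_sym e_irr no_isolated T_nonempty.
have [pos [curve [drawing crossed_once]]] := e_pop S blockS.
have pos_circle := pos_circle drawing; have pos_inj := pos_inj drawing.
apply: (end_block_reducible e_sym e_irr min_deg _ _
  (drawing_singly_crossed zS pos_circle pos_inj drawing crossed_once) S1).
- move=> i j iS jS /eqP; rewrite eq_nth_circular_seq // => /eqP //.
- move=> k y kS ky; have yS : y \in S.
    apply: adjS ky; last exact: nth_circular_seq_neq0.
    by apply: nth_circular_seq_in => //; case/andP: kS.
  exists (index y (circular_seq S z pos)).
    by rewrite -(size_circular_seq pos zS) index_mem mem_circular_seq.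
  by rewrite nth_index ?mem_circular_seq.
Qed.
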